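(* The variety of bounded distributive lattices (in the language $\wedge,\vee,\bot,\top$) is structurally complete.
   Context: A quasi-identity is an expression $\Sigma\Rightarrow\varphi\approx\psi$ with $\Sigma$ a finite set of identities (pairs of formulas); it is valid in a class of algebras if in each member every assignment satisfying all identities of $\Sigma$ satisfies $\varphi\approx\psi$. It is admissible in a quasivariety $\mathcal{Q}$ if for every substitution $\sigma$ (endomorphism of the algebra of formulas over countably infinitely many variables) such that $\sigma(\varphi')\approx\sigma(\psi')$ is valid in $\mathcal{Q}$ for all $\varphi'\approx\psi'\in\Sigma$, also $\sigma(\varphi)\approx\sigma(\psi)$ is valid in $\mathcal{Q}$. $\mathcal{Q}$ is structurally complete if each quasi-identity is admissible in $\mathcal{Q}$ exactly when it is valid in $\mathcal{Q}$. *)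

(* Defs.v *)
From Stdlib Require List.
From mathcomp Require Import all_boot all_order.

Set Implicit Arguments.
Unset Strict Implicit.
Unset Printing Implicit Defensive.

Record language : Type := Language { symb :> Type; arity : symb -> nat }.
Arguments arity {l} f.

Record algebra (L : language) : Type := Algebra {
  carrier :> Type;
  op : forall f : L, ('I_(arity f) -> carrier) -> carrier }.
Arguments op {L a} f args.

Definition homomorphism (L : language) (A B : algebra L) (h : A -> B) : Prop :=
  forall (f : L) (args : 'I_(arity f) -> A),
    h (op f args) = op f (fun i => h (args i)).

Inductive formula (L : language) : Type :=
| Var of nat
| App (f : L) of ('I_(arity f) -> formula L).
Arguments Var {L} n.
Arguments App {L} f args.

Definition formula_algebra (L : language) : algebra L :=
  @Algebra L (formula L) (@App L).

Definition substitution (L : language) (sigma : formula L -> formula L) : Prop :=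
  @homomorphism L (formula_algebra L) (formula_algebra L) sigma.

Fixpoint eval (L : language) (A : algebra L) (v : nat -> A) (phi : formula L)
    : A :=
  match phi with
  | Var n => v n
  | App f args => op f (fun i => eval v (args i))
  end.

Record identity (L : language) : Type :=
  Identity { lhs : formula L; rhs : formula L }.

Declare Scope identity_scope.
Delimit Scope identity_scope with ID.
Notation "phi ≈ psi" := (Identity phi psi) (at level 70, no associativity)
  : identity_scope.

Definition subst_identity (L : language) (sigma : formula L -> formula L)
    (e : identity L) : identity L :=
  Identity (sigma (lhs e)) (sigma (rhs e)).

Definition satisfies (L : language) (A : algebra L) (v : nat -> A)
    (e : identity L) : Prop :=
  eval v (lhs e) = eval v (rhs e).

Definition algebra_class (L : language) : Type := algebra L -> Prop.

Definition valid_identity (L : language) (Q : algebra_class L) (e : identity L)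
    : Prop :=
  forall A : algebra L, Q A -> forall v : nat -> A, satisfies v e.

(* The finite set of premises is given by a list enumerating it; only
   membership in this list is ever used. *)
Record quasi_identity (L : language) : Type := QuasiIdentity {
  premises : seq (identity L);
  conclusion : identity L }.

Definition valid (L : language) (Q : algebra_class L) (q : quasi_identity L)
    : Prop :=
  forall A : algebra L, Q A -> forall v : nat -> A,
    (forall e, List.In e (premises q) -> satisfies v e) ->
    satisfies v (conclusion q).

Definition admissible (L : language) (Q : algebra_class L)
    (q : quasi_identity L) : Prop :=
  forall sigma : formula L -> formula L, substitution sigma ->
    (forall e, List.In e (premises q) ->
       valid_identity Q (subst_identity sigma e)) ->
    valid_identity Q (subst_identity sigma (conclusion q)).

Definition structurally_complete (L : language) (Q : algebra_class L) : Prop :=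
  forall q : quasi_identity L, admissible Q q <-> valid Q q.

Definition variety (L : language) (E : identity L -> Prop) : algebra_class L :=
  fun A => forall e, E e -> forall v : nat -> A, satisfies v e.

Inductive bdl_symb : Type := MeetS | JoinS | BotS | TopS.

Definition bdl_arity (f : bdl_symb) : nat :=
  match f with MeetS | JoinS => 2 | BotS | TopS => 0 end.

Definition bdl_language : language := Language bdl_arity.

Declare Scope bdl_scope.
Delimit Scope bdl_scope with BDL.
Notation "x ∧ y" := (@App bdl_language MeetS (tnth [tuple x; y]))
  (at level 40, left associativity) : bdl_scope.
Notation "x ∨ y" := (@App bdl_language JoinS (tnth [tuple x; y]))
  (at level 50, left associativity) : bdl_scope.
Notation "⊥" := (@App bdl_language BotS (tnth [tuple])) (at level 0) : bdl_scope.
Notation "⊤" := (@App bdl_language TopS (tnth [tuple])) (at level 0) : bdl_scope.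

Local Open Scope identity_scope.
Local Open Scope bdl_scope.

Definition bdl_axioms : seq (identity bdl_language) :=
  let x := Var 0 in let y := Var 1 in let z := Var 2 in
  [:: x ∧ y ≈ y ∧ x;
      x ∨ y ≈ y ∨ x;
      x ∧ (y ∧ z) ≈ (x ∧ y) ∧ z;
      x ∨ (y ∨ z) ≈ (x ∨ y) ∨ z;
      x ∧ (x ∨ y) ≈ x;
      x ∨ (x ∧ y) ≈ x;
      x ∧ (y ∨ z) ≈ (x ∧ y) ∨ (x ∧ z);
      x ∧ ⊥ ≈ ⊥;
      x ∨ ⊤ ≈ ⊤].

Definition bounded_distributive_lattices : algebra_class bdl_language :=
  variety (fun e => List.In e bdl_axioms).

(* MathComp's bounded distributive lattices, seen as algebras, belong to the
   variety.  The converse inclusion is not stated because a tbDistrLatticeType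
   carries a choice operator, which an arbitrary algebra does not. *)
Definition algebra_of_lattice (d : Order.disp_t) (T : tbDistrLatticeType d)
    : algebra bdl_language :=
  @Algebra bdl_language T (fun f =>
    match f return ('I_(bdl_arity f) -> T) -> T with
    | MeetS => fun a => Order.meet (a ord0) (a ord_max)
    | JoinS => fun a => Order.join (a ord0) (a ord_max)
    | BotS => fun _ => Order.bottom
    | TopS => fun _ => Order.top
    end).

Import Order.Theory.

Lemma algebra_of_lattice_bdl (d : Order.disp_t) (T : tbDistrLatticeType d) :
  bounded_distributive_lattices (algebra_of_lattice T).
Proof.
move=> e He v; rewrite /satisfies; move: He => /=.
case=> [<-|] /=; first exact: meetC.
case=> [<-|] /=; first exact: joinC.
case=> [<-|] /=; first exact: meetA.
case=> [<-|] /=; first exact: joinA.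
case=> [<-|] /=; first exact: joinKI.
case=> [<-|] /=; first exact: meetKU.
case=> [<-|] /=; first exact: meetUr.
case=> [<-|] /=; first exact: meetx0.
case=> [<-|] /=; first exact: joinx1.
by [].
Qed.

(* Main.v *)
(** A variable can be removed by splitting: modulo any congruence of a
    distributive lattice, [x] and [y] agree as soon as [x ∧ a], [y ∧ a] agree and
    [x ∨ a], [y ∨ a] agree, and the two congruences so obtained from [a] collapse
    [a] with [⊤], respectively with [⊥].  Hence, to verify a quasi-identity, one
    may assume that its finitely many variables all take the values [⊥] and [⊤]
    modulo a congruence.  Such an assignment comes from the substitution of the
    constants [⊥] and [⊤] for the variables, and closed formulas have the same
    value, [⊥] or [⊤], in all algebras of the variety, so that admissibility
    applies.  This replaces the prime filter theorem. *)

From Stdlib Require List.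
From Stdlib Require Import FunctionalExtensionality.
From mathcomp Require Import all_boot all_order.
Require Import Defs.

Set Implicit Arguments.
Unset Strict Implicit.
Unset Printing Implicit Defensive.

(** * Evaluation, substitutions and congruences over an arbitrary language *)

Section UniversalAlgebra.

Variable L : language.
Implicit Types (A B : algebra L) (phi : formula L).

Lemma eval_ext A (v w : nat -> A) phi : v =1 w -> eval v phi = eval w phi.
Proof. by move=> /functional_extensionality ->. Qed.

Lemma eval_homomorphism A B (h : A -> B) (v : nat -> A) phi :
  homomorphism h -> h (eval v phi) = eval (fun n => h (v n)) phi.
Proof.
move=> hh; elim: phi => //= f args IH; rewrite hh; congr op.
exact: functional_extensionality.
Qed.

Lemma eval_substitution A (v : nat -> A) (sigma : formula L -> formula L) phi :
  substitution sigma ->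
  eval v (sigma phi) = eval (fun n => eval v (sigma (Var n))) phi.
Proof.
move=> hs; elim: phi => //= f args IH; rewrite hs /=; congr op.
exact: functional_extensionality.
Qed.

Fixpoint instance (s : nat -> formula L) (phi : formula L) : formula L :=
  match phi with
  | Var n => s n
  | App f args => App f (fun i => instance s (args i))
  end.

Lemma instance_substitution s : substitution (instance s).
Proof. by []. Qed.

(** Applying [sigma] and then evaluating under [v] is evaluation under the assignment
    [n ↦ eval v (sigma (Var n))], at which validity is used. *)
Lemma valid_admissible (Q : algebra_class L) (q : quasi_identity L) :
  valid Q q -> admissible Q q.
Proof.
move=> hq sigma hs hp A QA v.
rewrite /satisfies /= !(eval_substitution _ _ hs).
apply: hq => // e /hp /(_ A QA v).
by rewrite /satisfies /= !(eval_substitution _ _ hs).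
Qed.

(** A strict bound on the variable indices, hence [n.+1]; closed formulas get 0. *)
Fixpoint var_bound phi : nat :=
  match phi with
  | Var n => n.+1
  | App f args => \max_i var_bound (args i)
  end.

Lemma eval_eq_below A (v w : nat -> A) phi :
  (forall n, n < var_bound phi -> v n = w n) -> eval v phi = eval w phi.
Proof.
elim: phi => [n|f args IH] /= vw; first exact: vw.
congr op; apply: functional_extensionality => i; apply: IH => n ltn.
by apply: vw; apply: leq_trans ltn (leq_bigmax i).
Qed.

Lemma var_bound_identities (l : seq (identity L)) :
  exists N, forall e, List.In e l ->
    var_bound (lhs e) <= N /\ var_bound (rhs e) <= N.
Proof.
elim: l => [|e l [N hN]]; first by exists 0.
exists (maxn (maxn (var_bound (lhs e)) (var_bound (rhs e))) N) => e' /= [<-|/hN].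
  by rewrite !leq_max !leqnn !orbT.
by case=> h1 h2; rewrite !leq_max h1 h2 !orbT.
Qed.

Record congruence A (theta : A -> A -> Prop) : Prop := Congruence {
  cong_refl : forall x, theta x x;
  cong_sym : forall x y, theta x y -> theta y x;
  cong_trans : forall x y z, theta x y -> theta y z -> theta x z;
  cong_op : forall (f : L) (a b : 'I_(arity f) -> A),
    (forall i, theta (a i) (b i)) -> theta (op f a) (op f b) }.

Lemma congruence_eq A : congruence (@eq A).
Proof.
split=> //; first by move=> x y z -> ->.
by move=> f a b /functional_extensionality ->.
Qed.

Lemma cong_eval A (theta : A -> A -> Prop) (v w : nat -> A) phi :
  congruence theta -> (forall n, theta (v n) (w n)) ->
  theta (eval v phi) (eval w phi).
Proof. by move=> ht vw; elim: phi => //= f args IH; apply: cong_op. Qed.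

End UniversalAlgebra.

(** * Identities and congruences of bounded distributive lattices *)

Lemma tnth_pairE (T : Type) (a : 'I_2 -> T) :
  a = tnth [tuple a ord0; a ord_max].
Proof.
apply: functional_extensionality => -[[|[|//]] i].
  by rewrite (tnth_nth (a ord0)) /=; congr a; apply: val_inj.
by rewrite (tnth_nth (a ord0)) /=; congr a; apply: val_inj.
Qed.

Lemma tnth_nilE (T : Type) (a : 'I_0 -> T) : a = tnth [tuple].
Proof. by apply: functional_extensionality => -[]. Qed.

(** Arguments are listed by [tnth], as in the notations for formulas; extensionality brings any
    argument function to this form. *)
Definition bdl_meet (A : algebra bdl_language) (x y : A) : A :=
  @op bdl_language A MeetS (tnth [tuple x; y]).
Definition bdl_join (A : algebra bdl_language) (x y : A) : A :=
  @op bdl_language A JoinS (tnth [tuple x; y]).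
Definition bdl_bot (A : algebra bdl_language) : A :=
  @op bdl_language A BotS (tnth [tuple]).
Definition bdl_top (A : algebra bdl_language) : A :=
  @op bdl_language A TopS (tnth [tuple]).

Section BoundedDistributiveLattice.

Variable A : algebra bdl_language.
Hypothesis bdlA : bounded_distributive_lattices A.

Local Notation meet := (@bdl_meet A).
Local Notation join := (@bdl_join A).
Local Notation bot := (bdl_bot A).
Local Notation top := (bdl_top A).

Let op_meet a : @op bdl_language A MeetS a = meet (a ord0) (a ord_max).
Proof. by rewrite {1}(tnth_pairE a). Qed.

Let op_join a : @op bdl_language A JoinS a = join (a ord0) (a ord_max).
Proof. by rewrite {1}(tnth_pairE a). Qed.

Let op_bot a : @op bdl_language A BotS a = bot.
Proof. by rewrite (tnth_nilE a). Qed.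

Let op_top a : @op bdl_language A TopS a = top.
Proof. by rewrite (tnth_nilE a). Qed.

Let opE := (op_meet, op_join, op_bot, op_top).

Let axiomE k x y z : k < size bdl_axioms ->
  @satisfies _ A (nth x [:: x; y; z])
    (nth (Identity (Var 0) (Var 0)) bdl_axioms k).
Proof. by move=> hk; apply: bdlA; do 9 ?[case: k hk => [|k] hk /=; auto 10]. Qed.

Let meetC x y : meet x y = meet y x.
Proof. by have := @axiomE 0 x y x isT; rewrite /satisfies /= !opE. Qed.

Let joinC x y : join x y = join y x.
Proof. by have := @axiomE 1 x y x isT; rewrite /satisfies /= !opE. Qed.

Let meetA x y z : meet x (meet y z) = meet (meet x y) z.
Proof. by have := @axiomE 2 x y z isT; rewrite /satisfies /= !opE /= !opE. Qed.

Let joinA x y z : join x (join y z) = join (join x y) z.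
Proof. by have := @axiomE 3 x y z isT; rewrite /satisfies /= !opE /= !opE. Qed.

Let joinKI x y : meet x (join x y) = x.
Proof. by have := @axiomE 4 x y x isT; rewrite /satisfies /= !opE /= !opE. Qed.

Let meetKU x y : join x (meet x y) = x.
Proof. by have := @axiomE 5 x y x isT; rewrite /satisfies /= !opE /= !opE. Qed.

Let meetUr x y z : meet x (join y z) = join (meet x y) (meet x z).
Proof. by have := @axiomE 6 x y z isT; rewrite /satisfies /= !opE /= !opE. Qed.

Let meetx0 x : meet x bot = bot.
Proof. by have := @axiomE 7 x x x isT; rewrite /satisfies /= !opE /= !opE. Qed.

Let joinx1 x : join x top = top.
Proof. by have := @axiomE 8 x x x isT; rewrite /satisfies /= !opE /= !opE. Qed.

Let meetxx x : meet x x = x.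
Proof. by rewrite -{2}(meetKU x x) joinKI. Qed.

Let joinxx x : join x x = x.
Proof. by rewrite -{2}(joinKI x x) meetKU. Qed.

Let meetx1 x : meet x top = x.
Proof. by rewrite -(joinx1 x) joinKI. Qed.

Let joinx0 x : join x bot = x.
Proof. by rewrite -(meetx0 x) meetKU. Qed.

Let meetUl x y z : meet (join x y) z = join (meet x z) (meet y z).
Proof. by rewrite ![meet _ z]meetC meetUr. Qed.

(** The dual distributive law follows by expanding the right side and absorbing into [z]. *)
Let joinIl x y z : join (meet x y) z = meet (join x z) (join y z).
Proof.
rewrite meetUr meetUl [meet (join x z) z]meetC [join x z]joinC joinKI.
by rewrite -joinA [join (meet z y) z]joinC meetKU.
Qed.

Let meetIl x y z : meet (meet x y) z = meet (meet x z) (meet y z).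
Proof.
by rewrite [meet y z]meetC meetA -(meetA x z z) meetxx -!meetA [meet z y]meetC.
Qed.

Let joinUl x y z : join (join x y) z = join (join x z) (join y z).
Proof.
by rewrite [join y z]joinC joinA -(joinA x z z) joinxx -!joinA [join z y]joinC.
Qed.

Definition bool_embedding (b : bool) : A := if b then top else bot.

(** This lets closed formulas be evaluated in [bool], even if [A] is trivial and the map is not
    injective. *)
Lemma bool_embedding_homomorphism :
  @homomorphism bdl_language (algebra_of_lattice bool) A bool_embedding.
Proof.
case=> args /=; rewrite opE //.
- by case: (args ord0); case: (args ord_max);
    rewrite /= ?meetx1 ?meetx0 // meetC meetx0.
- by case: (args ord0); case: (args ord_max);
    rewrite /= ?joinx1 ?joinx0 // joinC joinx1.
Qed.

Section Congruences.

Variable theta : A -> A -> Prop.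
Hypothesis ctheta : congruence theta.

Lemma cong_meet x x' y y' : theta x x' -> theta y y' ->
  theta (meet x y) (meet x' y').
Proof.
move=> hx hy; apply: (cong_op ctheta) => -[[|[|//]] i];
  by rewrite (tnth_nth x) (tnth_nth x').
Qed.

Lemma cong_join x x' y y' : theta x x' -> theta y y' ->
  theta (join x y) (join x' y').
Proof.
move=> hx hy; apply: (cong_op ctheta) => -[[|[|//]] i];
  by rewrite (tnth_nth x) (tnth_nth x').
Qed.

(** Compatibility with the constants is mere reflexivity, so [h] may be [meet^~ a] or [join^~ a],
    which can move [top] or [bot]. *)
Lemma congruence_preim (h : A -> A) :
  {morph h : x y / meet x y} -> {morph h : x y / join x y} ->
  congruence (fun x y => theta (h x) (h y)).
Proof.
case: ctheta => tr ts tt _ hI hU; split; [by move=> x; apply: tr | | |].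
- by move=> x y; apply: ts.
- by move=> x y z; apply: tt.
case=> a b ab; rewrite !opE //.
- by rewrite !hI; apply: cong_meet.
- by rewrite !hU; apply: cong_join.
Qed.

(** Modulo [theta]: x = x ∧ (x ∨ a) ~ x ∧ (y ∨ a) = (x ∧ y) ∨ (x ∧ a) ~ (x ∧ y) ∨ (y ∧ a) = y ∧ (x ∨
    a) ~ y ∧ (y ∨ a) = y. *)
Lemma cong_split a x y :
  theta (meet x a) (meet y a) -> theta (join x a) (join y a) -> theta x y.
Proof.
case: ctheta => tr _ tt _ hI hU; rewrite -(joinKI x a) -(joinKI y a).
apply: (tt _ (meet x (join y a))); first exact: cong_meet.
rewrite [meet y (join y a)]meetC.
apply: (tt _ (meet y (join x a))).
  by rewrite !meetUr [meet y x]meetC; apply: cong_join.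
by rewrite [meet (join y a) y]meetC; apply: cong_meet.
Qed.

(** Once [top] ~ [bot], every z = z ∧ ⊤ ~ z ∧ ⊥ = ⊥. *)
Lemma cong_collapse x y b :
  theta (bool_embedding b) (bool_embedding (~~ b)) -> theta x y.
Proof.
case: ctheta => tr ts tt _ hb.
have {hb} h01 : theta top bot by case: b hb => //; apply: ts.
have h z : theta z bot by rewrite -{1}(meetx1 z) -(meetx0 z); apply: cong_meet.
exact: tt (h x) (ts _ _ (h y)).
Qed.

End Congruences.

(** Induction on the number [N] of variables not yet Boolean; [theta] and [u] vary, since each step
    splits at [v N] and enlarges the congruence. *)
Lemma cong_of_bool_valued (v : nat -> A) (phi psi : formula bdl_language) :
  (forall (theta : A -> A -> Prop) (u : nat -> bool), congruence theta ->
     (forall n, theta (v n) (bool_embedding (u n))) ->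
     theta (eval v phi) (eval v psi)) ->
  forall N (theta : A -> A -> Prop) (u : nat -> bool), congruence theta ->
    (forall n, N <= n -> theta (v n) (bool_embedding (u n))) ->
    theta (eval v phi) (eval v psi).
Proof.
move=> hbool; elim=> [|N IH] theta u ct hu.
  by apply: hbool ct _ => n; apply: hu.
apply: (cong_split ct (a := v N)).
(* Here [v N] and [top] have the same meet with [v N], so variable [N] receives the value true;
   dually, it receives false for joins. *)
- apply: (IH (fun x y => theta (meet x (v N)) (meet y (v N)))
    (fun n => (n == N) || u n)).
    by apply: (congruence_preim ct (h := meet^~ (v N))) => x y;
      [apply: meetIl|apply: meetUl].
  move=> n; rewrite leq_eqVlt eq_sym; case: eqP => [-> _|_ /= /hu hn].
    by rewrite /= meetxx meetC meetx1; apply: cong_refl.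
  by apply: (cong_meet ct) => //; apply: cong_refl.
- apply: (IH (fun x y => theta (join x (v N)) (join y (v N)))
    (fun n => (n != N) && u n)).
    by apply: (congruence_preim ct (h := join^~ (v N))) => x y;
      [apply: joinIl|apply: joinUl].
  move=> n; rewrite leq_eqVlt eq_sym; case: eqP => [-> _|_ /= /hu hn].
    by rewrite /= joinxx joinC joinx0; apply: cong_refl.
  by apply: (cong_join ct) => //; apply: cong_refl.
Qed.

End BoundedDistributiveLattice.

(** * Constant substitutions and admissibility *)

Definition bool_formula (b : bool) : formula bdl_language :=
  if b then (⊤)%BDL else (⊥)%BDL.

Lemma eval_bool_formula (A : algebra bdl_language) (v : nat -> A) b :
  eval v (bool_formula b) = bool_embedding A b.
Proof. by case: b; congr op; apply: tnth_nilE. Qed.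

Lemma eval_bool_instance (A : algebra bdl_language) (v : nat -> A)
    (u : nat -> bool) phi : bounded_distributive_lattices A ->
  eval v (instance (fun n => bool_formula (u n)) phi) =
  bool_embedding A (@eval _ (algebra_of_lattice bool) u phi).
Proof.
move=> hA; rewrite (eval_substitution _ _ (@instance_substitution _ _)).
rewrite (eval_homomorphism _ _ (bool_embedding_homomorphism hA)).
by apply: eval_ext => n; apply: eval_bool_formula.
Qed.

Lemma admissible_valid (q : quasi_identity bdl_language) :
  admissible bounded_distributive_lattices q ->
  valid bounded_distributive_lattices q.
Proof.
move=> adm A hA v hv.
have [N hN] := var_bound_identities (conclusion q :: premises q).
(* Variables from [N] on do not occur in [q]; sending them to [bot] makes them Boolean already
   modulo equality, where the reduction starts. *)
pose w n := if n < N then v n else bool_embedding A false.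
have evalw e : List.In e (conclusion q :: premises q) ->
    eval v (lhs e) = eval w (lhs e) /\ eval v (rhs e) = eval w (rhs e).
  by move=> /hN[hl hr]; split; apply: eval_eq_below => n hn;
    rewrite /w (leq_trans hn).
have [ewl ewr] := evalw _ (or_introl erefl).
rewrite /satisfies ewl ewr.
apply: (@cong_of_bool_valued A hA w _ _ _ N eq (fun=> false));
  [|exact: congruence_eq|by move=> n; rewrite leqNgt /w => /negbTE ->].
move=> theta u ct hu; pose beval := @eval _ (algebra_of_lattice bool) u.
have evalE phi : theta (eval w phi) (bool_embedding A (beval phi)).
  rewrite (eval_homomorphism _ _ (bool_embedding_homomorphism hA)).
  exact: cong_eval.
(* If [u] satisfies the premises in [bool], their constant instances are valid in the whole variety,
   and admissibility yields the conclusion. *)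
have [prem|] := List.Forall_Exists_dec (fun e => beval (lhs e) = beval (rhs e))
  (fun e => decP eqP) (premises q).
  have /adm /(_ _ A hA w) :=
    @instance_substitution _ (fun n => bool_formula (u n)).
  rewrite /satisfies /= !eval_bool_instance // => concl.
  apply: (cong_trans ct) (evalE _) _; rewrite concl.
    exact: cong_sym (evalE _).
  move=> e he B hB v'; rewrite /satisfies /= !eval_bool_instance //.
  by congr bool_embedding; move/List.Forall_forall: prem; apply.
(* A premise failing under [u] still holds in [A] under [v], so [theta] identifies [top] with [bot]
   and hence all elements. *)
move=> /List.Exists_exists [e [he neq]].
apply: (cong_collapse hA ct _ _ (b := beval (lhs e))).
have -> : ~~ beval (lhs e) = beval (rhs e).
  by move: neq; case: (beval _); case: (beval _).
apply: (cong_trans ct) (cong_sym ct (evalE _)) _.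
have [<- _] := evalw e (or_intror he).
have [_ er] := evalw e (or_intror he).
by rewrite (hv e he) er.
Qed.

Theorem proposition13 : structurally_complete bounded_distributive_lattices.
Proof. by move=> q; split; [apply: admissible_valid|apply: valid_admissible]. Qed.
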